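(* Assume that the Relative Four-Row Descent Hypothesis (stated in full in the context) holds in every degree $d$ with $\mu(d)\le 4$. Then, for every monomial $x^a\in P(4)$, $$x^a\in\mathcal H(P(4))\quad\Longrightarrow\quad \sigma(x^a)\in\mathcal H(B(4)).$$ That is, if $x^a$ is hit in $P(4)$, then its orbit sum is hit in $B(4)$.
   Context: **Steenrod action and hits.** $P(4)=\mathbf F_2[x_1,\dots,x_4]$, $|x_i|=1$; the total Steenrod square $\mathrm{Sq}=\sum_r\mathrm{Sq}^r$ is the algebra endomorphism with $\mathrm{Sq}(x_i)=x_i+x_i^2$. $\Sigma_4$ permutes the variables; $B(4)=P(4)^{\Sigma_4}$. For $M=P(4)$ or $B(4)$, $\mathcal H^d(M)=\sum_{r>0}\mathrm{Sq}^r(M^{d-r})$ and $\mathcal H(M)=\bigoplus_d\mathcal H^d(M)$; elements of $\mathcal H(M)$ are called hit in $M$. For a monomial $f$, $\sigma(f)\in B(4)$ is the sum of the distinct monomials in its $\Sigma_4$-orbit. $\mathscr S:P^d(4)\to B^d(4)$ is the $\mathbf F_2$-linear map with $\mathscr S(x^a)=\sigma(x^a)$ on monomials. **Blocks.** For $a=(a_1,\dots,a_4)\in\mathbf N^4$ write $a_i=\sum_{j\ge1}a_{ij}2^{j-1}$ with $a_{ij}\in\{0,1\}$. The block $F=F(a)$ is the array $(a_{ij})$, identified with $a$; $x^F=x^a$, $\sigma(F)=\sigma(x^a)$, degree $|F|=\sum a_i$. $\omega(F)=(\omega_1,\omega_2,\dots)$ with $\omega_j=\sum_i a_{ij}$.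 $\alpha(q)$ is the number of nonzero binary digits of $q$; $\alpha^*(F)$ is the nondecreasing rearrangement of $(\alpha(a_1),\dots,\alpha(a_4))$; $\lambda(F)$ is the nonincreasing rearrangement of $a$. The measure is $\mathfrak m(F)=(\omega(F),\alpha^*(F),\lambda(F))$; measures are compared lexicographically (left lexicographic order $<_l$ on $\omega$, then lexicographic on $\alpha^*$, then lexicographic on $\lambda$), strict order denoted $\prec$. Set $W^d_{\prec\mathfrak m}=\mathrm{span}_{\mathbf F_2}\{x^G:|G|=d,\ \mathfrak m(G)\prec\mathfrak m,\ x^G\in\mathcal H^d(P(4))\}$. **Spikes.** A spike is a monomial all of whose exponents have the form $2^r-1$, $r\ge0$. $\mu(d)$ is the least $s$ such that $d=\sum_{i=1}^s(2^{r_i}-1)$ with all $r_i>0$ ($\mu(0)=0$). For $\mu(d)\le4$, $\omega_{\min}(d)$ is the $<_l$-least weight sequence $\omega$ among degree-$d$ spikes. **Relative detectors.** $K_d(4)$ is the space of functionals on $P^d(4)$ vanishing on $\mathcal H^d(P(4))$; $K^\Sigma_d(4)$ is the space of functionals on $B^d(4)$ vanishing on $\mathcal H^d(B(4))$; $\rho_d:K_d(4)\to K^\Sigma_d(4)$ is restriction; $\mathcal R_d(4)=K^\Sigma_d(4)/\rho_d(K_d(4))$. For $b\in B^d(4)\cap\mathcal H^d(P(4))$, $[b]_{\rm rel}$ is its class in $\mathcal C_d(4)=(B^d(4)\cap\mathcal H^d(P(4)))/\mathcal H^d(B(4))$; the pairing $\langle[b]_{\rm rel},[\Theta]_{\rm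 rel}\rangle=\Theta(b)$ between $\mathcal C_d(4)$ and $\mathcal R_d(4)$ is well defined. **Preimage constructions.** Let $C=(c_1,\dots,c_4)\in\mathbf N^4$ and $u\ge0$ be such that the binary digit of $c_i$ in position $2^u$ is $1$, and put $F=C+2^ue_i$. The single-square preimage equation is the Cartan expansion $\mathrm{Sq}^{2^u}(x^C)=x^F+\sum_{j\ne i}\varepsilon_jx^{C+2^ue_j}+L_{C,u}$, where $\varepsilon_j\in\{0,1\}$ is the binary digit of $c_j$ in position $2^u$ and $L_{C,u}$ is the sum of the Cartan summands in which at least two coordinates receive positive increments. A multi-square preimage construction is a finite sum of such equations together with exact expansions of $\mathrm{Sq}^r(x^C)$, $r>0$, where every occurring increment $r_i$ in coordinate $i$ satisfies the condition that each binary digit of $r_i$ is at most the corresponding digit of $c_i$. **Relative Four-Row Descent Hypothesis in degree $d$** (where $\mu(d)\le4$). For every degree-$d$ four-row block $F$ with $x^F\in\mathcal H^d(P(4))$, $\omega(F)\not<_l\omega_{\min}(d)$, and exponent tuple having nontrivial stabilizer in $\Sigma_4$ (i.e. with some repeated exponent), putting $\mathfrak m=\mathfrak m(F)$, there exist $h_B\in\mathcal H^d(B(4))$, $p_<\in W^d_{\prec\mathfrak m}$ and $r_F\in B^d(4)\cap\mathcal H^d(P(4))$ such that $$\sigma(F)=h_B+\mathscr S(p_<)+r_F;$$ the equality is obtained from a finite collection of single-square and multi-square preimage constructions whose Steenrod preimages are fixed by the relevant source stabilizers; and $\langle[r_F]_{\rm rel},[\Theta]_{\rm rel}\rangle=0$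 for every $[\Theta]_{\rm rel}\in\mathcal R_d(4)$. *)

(* Defs.v *)
From HB Require Import structures.
From mathcomp Require Import all_boot all_fingroup all_algebra.
From mathcomp Require Import mpoly.

Set Implicit Arguments.
Unset Strict Implicit.
Unset Printing Implicit Defensive.

Import GRing.Theory.
Local Open Scope ring_scope.

Notation P4 := {mpoly 'F_2[4]}.
Notation block := 'X_{1..4}.

Definition Sq_total (p : P4) : P4 := p \mPo [tuple 'X_i + 'X_i ^+ 2 | i < 4].

(* Sq^r raises degree by r, so on the degree-k component it is the *)
(* degree-(k+r) component of the total square. *)
Definition Sq (r : nat) (p : P4) : P4 :=
  \sum_(k < msize p) pihomog mdeg (k + r)%N (Sq_total (pihomog mdeg k p)).

Definition P4full : pred P4 := predT.
Definition B4 : pred P4 := [pred p | p \is @symmetric 4 'F_2].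

Definition graded (M : pred P4) (d : nat) : pred P4 :=
  [pred p | (p \in M) && (p \is d.-homog)].

(* H^d(M); the terms with r > d are absent because M^(d-r) = 0. *)
Definition hit_deg (M : pred P4) (d : nat) (p : P4) : Prop :=
  exists2 f : nat -> P4,
    forall r, (1 <= r <= d)%N -> f r \in graded M (d - r)
  & p = \sum_(1 <= r < d.+1) Sq r (f r).

Definition hit (M : pred P4) (p : P4) : Prop :=
  exists n, exists2 h : nat -> P4,
    forall d, (d < n)%N -> hit_deg M d (h d) & p = \sum_(d < n) h d.

Definition permute_block (F : block) (s : 'S_4) : block :=
  [multinom F (s i) | i < 4].

Definition orbit_sum (F : block) : P4 :=
  \sum_(G <- undup [seq permute_block F s | s : 'S_4]) 'X_[G].

Definition symmetrize (p : P4) : P4 :=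
  \sum_(G <- msupp p) p@_G *: orbit_sum G.

Definition stabilizer (F : block) : {set 'S_4} :=
  [set s | permute_block F s == F].

(* Binary positions are numbered from 0. *)
Definition bit (a j : nat) : bool := odd (a %/ 2 ^ j)%N.

(* Positions j >= q carry the digit 0 since q < 2^q. *)
Definition alpha (q : nat) : nat := (\sum_(j < q) bit q j)%N.

Definition omega (F : block) (j : nat) : nat := (\sum_(i < 4) bit (F i) j)%N.

Definition alpha_star (F : block) : seq nat :=
  sort leq [seq alpha (F i) | i : 'I_4].

Definition lambda (F : block) : seq nat := sort geq [seq F i | i : 'I_4].

Definition lex_lt (u v : nat -> nat) : Prop :=
  exists2 k, forall j, (j < k)%N -> u j = v j & (u k < v k)%N.

(* The length-4 sequences alpha_star and lambda enter padded by zeros, which *)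
(* does not affect their lexicographic comparison. *)
Record block_measure := BlockMeasure {
  weights : nat -> nat;
  digit_counts : nat -> nat;
  exponents : nat -> nat }.

Definition measure_of (F : block) : block_measure :=
  BlockMeasure (omega F) (nth 0%N (alpha_star F)) (nth 0%N (lambda F)).

Definition measure_lt (m m' : block_measure) : Prop :=
  lex_lt (weights m) (weights m') \/
  (weights m =1 weights m' /\
   (lex_lt (digit_counts m) (digit_counts m') \/
    (digit_counts m =1 digit_counts m' /\
     lex_lt (exponents m) (exponents m')))).

Definition hit_span_below (d : nat) (m : block_measure) (p : P4) : Prop :=
  exists (s : seq block) (c : block -> 'F_2),
    (forall G, G \in s ->
       [/\ mdeg G = d, measure_lt (measure_of G) m & hit_deg P4full d 'X_[G]])
    /\ p = \sum_(G <- s) c G *: 'X_[G].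

Definition spike (F : block) : Prop := forall i, exists r, F i = (2 ^ r - 1)%N.

(* Any r with 2^r - 1 <= d satisfies r <= d. *)
Definition spike_sum (d s : nat) : bool :=
  [exists r : {ffun 'I_s -> 'I_d.+1},
     [forall i, (0 < r i)%N] && (d == \sum_(i < s) (2 ^ r i - 1))%N].

Lemma spike_sum_ex d : exists s, spike_sum d s.
Proof.
exists d; apply/existsP; exists [ffun=> inord 1].
case: d => [|d].
  by apply/andP; split; [apply/forallP=> -[] | rewrite big_ord0].
apply/andP; split; first by apply/forallP=> i; rewrite ffunE inordK.
under eq_bigr do rewrite ffunE inordK //.
by rewrite sum_nat_const card_ord muln1.
Qed.

Definition mu (d : nat) : nat := ex_minn (spike_sum_ex d).

Definition is_omega_min (d : nat) (w : nat -> nat) : Prop :=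
  (exists Z, [/\ spike Z, mdeg Z = d & omega Z =1 w]) /\
  (forall Z, spike Z -> mdeg Z = d -> ~ lex_lt (omega Z) w).

(* A functional on a subspace D of P4 is represented by a function on P4 that *)
(* is linear on D; only its values on D are meaningful, so restriction to a *)
(* smaller subspace leaves the representing function unchanged. *)
Definition functional_on (D : pred P4) (f : P4 -> 'F_2) : Prop :=
  forall c p q, p \in D -> q \in D -> f (c *: p + q) = c * f p + f q.

Definition K (d : nat) (kappa : P4 -> 'F_2) : Prop :=
  functional_on (graded P4full d) kappa /\
  (forall p, hit_deg P4full d p -> kappa p = 0).

Definition KSigma (d : nat) (Theta : P4 -> 'F_2) : Prop :=
  functional_on (graded B4 d) Theta /\
  (forall p, hit_deg B4 d p -> Theta p = 0).

(* B^d(4) :&: H^d(P(4)), the numerator of C_d(4). *)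
Definition relative_cycle (d : nat) (b : P4) : Prop :=
  b \in graded B4 d /\ hit_deg P4full d b.

(* Equality of classes in C_d(4) and in R_d(4). *)
Definition rel_eqC (d : nat) (b b' : P4) : Prop := hit_deg B4 d (b' - b).

Definition rel_eqR (d : nat) (Theta Theta' : P4 -> 'F_2) : Prop :=
  exists2 kappa, K d kappa
  & forall b, b \in graded B4 d -> Theta' b = Theta b + kappa b.

Definition rel_pairing (b : P4) (Theta : P4 -> 'F_2) : 'F_2 := Theta b.

Lemma rel_pairing_wd d b b' Theta Theta' :
    relative_cycle d b -> relative_cycle d b' ->
    KSigma d Theta -> KSigma d Theta' ->
    rel_eqC d b b' -> rel_eqR d Theta Theta' ->
  rel_pairing b' Theta' = rel_pairing b Theta.
Proof.
move=> [bB bH] [b'B b'H] [linT vanT] _ bb' [kap [_ vank] TT'].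
rewrite /rel_pairing TT' // vank // addr0.
have bbB : b' - b \in graded B4 d.
  case/andP: bB b'B => /= bS bh /andP[/= b'S b'h].
  by apply/andP; split=> /=; [exact: rpredB | exact: rpredB].
have := linT 1 (b' - b) b bbB bB.
by rewrite scale1r subrK (vanT (b' - b)) // mulr0 add0r.
Qed.

(* Every binary digit of a is at most the corresponding digit of b. *)
Definition digits_le (a b : nat) : bool := [forall j : 'I_a, bit a j ==> bit b j].

(* r = (r_1, ..., r_4) of total degree n occurs in Sq^n(x^C) iff each *)
(* binomial coefficient (c_i choose r_i) is odd. *)
Definition cartan_increment (n : nat) (C r : block) : bool :=
  (mdeg r == n) && [forall i, digits_le (r i) (C i)].

Definition cartan_expansion (n : nat) (C : block) : P4 :=
  \sum_(r : 'X_{1..4 < n.+1} | cartan_increment n C r) 'X_[C + bmnm r].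

Definition cartan_rest (C : block) (u : nat) : P4 :=
  \sum_(r : 'X_{1..4 < (2 ^ u).+1} | cartan_increment (2 ^ u) C r
          && (2 <= #|[set i | 0 < bmnm r i]|)%N) 'X_[C + bmnm r].

(* [SingleSquare C u i] stands for the equation *)
(*   Sq^(2^u)(x^C) = x^F + sum_(j != i) eps_j x^(C + 2^u e_j) + L_(C,u) *)
(* with F = C + 2^u e_i, and [Expansion r C] for the exact expansion of *)
(* Sq^r(x^C). *)
Inductive preimage_step :=
  | SingleSquare (C : block) (u : nat) (i : 'I_4)
  | Expansion (r : nat) (C : block).

Definition step_degree (t : preimage_step) : nat :=
  match t with SingleSquare _ u _ => 2 ^ u | Expansion r _ => r end.

Definition step_preimage (t : preimage_step) : block :=
  match t with SingleSquare C _ _ => C | Expansion _ C => C end.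

Definition step_valid (t : preimage_step) : bool :=
  match t with SingleSquare C u i => bit (C i) u | Expansion r _ => (0 < r)%N end.

Definition step_rhs (t : preimage_step) : P4 :=
  match t with
  | SingleSquare C u i =>
      'X_[C + U_(i) *+ (2 ^ u)]
      + \sum_(j < 4 | j != i) (bit (C j) u)%:R *: 'X_[C + U_(j) *+ (2 ^ u)]
      + cartan_rest C u
  | Expansion r C => cartan_expansion r C
  end.

(* A finite sum of steps, used to eliminate the monomial of its source block. *)
Record preimage_construction := PreimageConstruction {
  source : block;
  steps : seq preimage_step }.

Definition construction_rhs (t : preimage_construction) : P4 :=
  \sum_(st <- steps t) step_rhs st.

(* The polynomial to which the construction applies Sq^r. *)
Definition construction_preimage (t : preimage_construction) (r : nat) : P4 :=
  \sum_(st <- steps t | step_degree st == r) 'X_[step_preimage st].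

Definition construction_valid (d : nat) (t : preimage_construction) : Prop :=
  [/\ all step_valid (steps t),
      all (fun st => mdeg (step_preimage st) + step_degree st == d)%N (steps t)
    & (construction_rhs t)@_(source t) = 1].

Definition stabilizer_fixed (t : preimage_construction) : Prop :=
  forall r s, s \in stabilizer (source t) ->
    msym s (construction_preimage t r) = construction_preimage t r.

(* Relative transfer from the stabilizer of G to the full symmetric group; *)
(* [msym] is a right action, so it is independent of representatives on *)
(* stabilizer-fixed polynomials.  It sends x^G to its orbit sum. *)
Definition transfer (G : block) (p : P4) : P4 :=
  \sum_(A in rcosets (stabilizer G) [set: 'S_4]) msym (repr A) p.

Definition transferred_squares (d : nat) (t : preimage_construction) : P4 :=
  \sum_(1 <= r < d.+1) Sq r (transfer (source t) (construction_preimage t r)).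

(* The equality sigma(F) = h + S(p) + r arises by transferring and adding the *)
(* equations of finitely many constructions: their left-hand sides give h and *)
(* their right-hand sides give sigma(F) - S(p) - r. *)
Definition obtained_from_preimages (d : nat) (F : block) (h p r : P4) : Prop :=
  exists k (t : 'I_k -> preimage_construction),
    [/\ forall i, construction_valid d (t i) /\ stabilizer_fixed (t i),
        h = \sum_(i < k) transferred_squares d (t i)
      & orbit_sum F - symmetrize p - r =
          \sum_(i < k) transfer (source (t i)) (construction_rhs (t i))].

Definition relative_descent_hypothesis (d : nat) : Prop :=
  forall F : block,
    mdeg F = d ->
    hit_deg P4full d 'X_[F] ->
    (forall w, is_omega_min d w -> ~ lex_lt (omega F) w) ->
    stabilizer F != [set 1%g] ->
    exists h p r : P4,
      [/\ hit_deg B4 d h,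
          hit_span_below d (measure_of F) p
        & relative_cycle d r] /\
      [/\ orbit_sum F = h + symmetrize p + r,
          obtained_from_preimages d F h p r
        & forall Theta, KSigma d Theta -> rel_pairing r Theta = 0].

(* Main.v *)
(* The descent hypothesis reduces sigma(F) to orbit sums of hit monomials of
   smaller measure: r_F is killed by every functional vanishing on the hit
   symmetric polynomials, hence is itself hit in B(4).  If the exponents are
   distinct, summing a hit equation over Sigma_4 suffices.

   In the remaining cases (mu(d) > 4, or omega(F) below the minimal spike) we use
   L(x) = x + x^2 + ... + x^(2^(N-1)), for which Sq(L(x)) = x + x^(2^N) is x up to
   high degree.  Write x^F = g h^(2^(s+1)) with g having exponents < 2^(s+1), and
   let Psi be h^(2^s) times g with every x^(2^t) replaced by L(x)^(2^t).  Then x^F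
   is the degree-d part of Sq(Psi), so it equals the degree-d part of Psi modulo
   hit polynomials.  A monomial of that part either has a smaller weight in a
   column below s or would exhibit a spike that cannot exist.  The construction
   is equivariant, so it can be summed over the orbit of F, and one inducts on
   omega. *)
From HB Require Import structures.
Require Import Defs.
From Stdlib Require Import Classical.
From mathcomp Require Import all_boot all_fingroup all_algebra zify ring.
From mathcomp Require Import mpoly.

Set Implicit Arguments.
Unset Strict Implicit.
Unset Printing Implicit Defensive.

Import GRing.Theory.
Local Open Scope ring_scope.

(** * The total square as a ring morphism commuting with permutations *)

HB.instance Definition _ := GRing.RMorphism.copy Sq_total
  (comp_mpoly [tuple 'X_i + 'X_i ^+ 2 | i < 4]).
HB.instance Definition _ := GRing.Linear.copy Sq_total
  (comp_mpoly [tuple 'X_i + 'X_i ^+ 2 | i < 4]).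

Lemma P4_pchar2 : 2%N \in [pchar P4].
Proof.
rewrite inE /= -[2%:R]/((2%:R : nat)%:R) -mpolyC_nat; apply/eqP.
by rewrite (_ : 2%:R = 0 :> 'F_2) ?mpolyC0 //; apply/val_inj.
Qed.

Lemma Sq_totalX i : Sq_total 'X_i = 'X_i + 'X_i ^+ 2.
Proof. by rewrite /Sq_total comp_mpolyXU -tnth_nth tnth_mktuple. Qed.

Lemma msymXU (s : 'S_4) i : msym s ('X_i : P4) = 'X_(s i).
Proof.
rewrite msymX; congr 'X_[_]; apply/mnmP=> j; rewrite !mnmE.
by rewrite -(inj_eq (@perm_inj _ s)) permKV.
Qed.

Lemma Sq_total_sum (I : Type) (r : seq I) (P : pred I) (F : I -> P4) :
  Sq_total (\sum_(i <- r | P i) F i) = \sum_(i <- r | P i) Sq_total (F i).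
Proof. exact: raddf_sum. Qed.

Lemma Sq_total_prod (I : Type) (r : seq I) (P : pred I) (F : I -> P4) :
  Sq_total (\prod_(i <- r | P i) F i) = \prod_(i <- r | P i) Sq_total (F i).
Proof. exact: rmorph_prod. Qed.

Lemma Sq_totalZ c p : Sq_total (c *: p) = c *: Sq_total p.
Proof. exact: linearZ. Qed.

Lemma Sq_totalD p q : Sq_total (p + q) = Sq_total p + Sq_total q.
Proof. exact: raddfD. Qed.

Lemma Sq_total1 : Sq_total 1 = 1.
Proof. exact: rmorph1. Qed.

Lemma Sq_totalM p q : Sq_total (p * q) = Sq_total p * Sq_total q.
Proof. exact: rmorphM. Qed.

Lemma Sq_total0 : Sq_total 0 = 0.
Proof. exact: raddf0. Qed.

Lemma msym_sum s (I : Type) (r : seq I) (P : pred I) (F : I -> P4) :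
  msym s (\sum_(i <- r | P i) F i) = \sum_(i <- r | P i) msym s (F i).
Proof. exact: raddf_sum. Qed.

Lemma msym_prod s (I : Type) (r : seq I) (P : pred I) (F : I -> P4) :
  msym s (\prod_(i <- r | P i) F i) = \prod_(i <- r | P i) msym s (F i).
Proof. exact: rmorph_prod. Qed.

Lemma msymXn s k (p : P4) : msym s (p ^+ k) = msym s p ^+ k.
Proof. exact: rmorphXn. Qed.

Lemma Sq_totalXn k (p : P4) : Sq_total (p ^+ k) = Sq_total p ^+ k.
Proof. exact: rmorphXn. Qed.

(** Both maps are ring morphisms, so it suffices to compare them on the variables. *)
Lemma msym_Sq_total s p : msym s (Sq_total p) = Sq_total (msym s p).
Proof.
have HX i : msym s (Sq_total 'X_i) = Sq_total (msym s 'X_i).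
  by rewrite Sq_totalX msymXU Sq_totalX rmorphD rmorphXn /= msymXU.
have Hm m : msym s (Sq_total 'X_[m]) = Sq_total (msym s 'X_[m]).
  rewrite mpolyXE_id Sq_total_prod.
  rewrite msym_prod.
  rewrite msym_prod.
  rewrite Sq_total_prod.
  apply: eq_bigr => i _.
  rewrite Sq_totalXn.
  rewrite msymXn.
  rewrite msymXn.
  rewrite Sq_totalXn.
  by rewrite HX.
rewrite [p]mpolyE Sq_total_sum !msym_sum Sq_total_sum.
by apply: eq_bigr => m _; rewrite Sq_totalZ !msymZ Sq_totalZ Hm.
Qed.

(** * Monomials up to error terms of controlled degree *)

Definition approx (A : nat -> nat -> bool) (m : block) (p : P4) :=
  forall n, n \in msupp (p - 'X_[m]) -> A (mdeg m) (mdeg n).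

(** The two closure properties answer the two kinds of error in a product of approximations: an
    error times a monomial, and an error times an error. *)
Definition additive_rel (A : nat -> nat -> bool) :=
  (forall a b c, A a b -> A (a + c)%N (b + c)%N) /\
  (forall a b a' b', A a b -> A a' b' -> A (a + a')%N (b + b')%N).

Lemma msuppM_ex (p q : P4) n : n \in msupp (p * q) ->
  exists m1 m2, [/\ m1 \in msupp p, m2 \in msupp q & n = (m1 + m2)%MM].
Proof. by move/msuppM_le/allpairsP => [[m1 m2] /= [? ? ->]]; exists m1, m2. Qed.

Lemma approxM A m m' p p' : additive_rel A ->
  approx A m p -> approx A m' p' -> approx A (m + m')%MM (p * p').
Proof.
move=> [Ac AD] Hp Hp' n.
have -> : p * p' - 'X_[m + m'] = (p - 'X_[m]) * (p' - 'X_[m'])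
    + (p - 'X_[m]) * 'X_[m'] + 'X_[m] * (p' - 'X_[m']).
  by rewrite mpolyXD; ring.
move/msuppD_le; rewrite mem_cat => /orP[/msuppD_le|].
  rewrite mem_cat => /orP[] /msuppM_ex[m1 [m2 [H1 H2 ->]]]; rewrite !mdegD.
    by apply: AD; [exact: Hp | exact: Hp'].
  by move/mem_msuppXP: H2 => <-; apply/Ac/Hp.
move/msuppM_ex=> [m1 [m2 [H1 H2 ->]]]; rewrite !mdegD.
by move/mem_msuppXP: H1 => <-; rewrite !(addnC (mdeg m)); apply/Ac/Hp'.
Qed.

Lemma approx1 A : approx A 0%MM 1.
Proof. by move=> n; rewrite mpolyX0 subrr msupp0. Qed.

Lemma approx_exp A m p k : additive_rel A ->
  approx A m p -> approx A (m *+ k)%MM (p ^+ k).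
Proof.
move=> HA Hp; elim: k => [|k IH]; first by rewrite expr0 mulm0n; exact: approx1.
by rewrite exprS mulmS; apply: approxM.
Qed.

Lemma approx_prod A (m : 'I_4 -> block) (p : 'I_4 -> P4) : additive_rel A ->
  (forall i, approx A (m i) (p i)) ->
  approx A (\sum_i m i)%MM (\prod_i p i).
Proof.
move=> HA Hp; elim/big_rec2: _ => [|i y1 y2 _ H]; first exact: approx1.
by apply: approxM.
Qed.

Lemma approx_Sq_total m : approx ltn m (Sq_total 'X_[m]).
Proof.
have HA : additive_rel ltn by split=> *; lia.
rewrite mpolyXE_id Sq_total_prod {1}(multinomUE_id m).
apply: approx_prod => // i; rewrite Sq_totalXn.
apply: approx_exp => // n; rewrite Sq_totalX addrAC subrr add0r.
by rewrite mpolyXn => /mem_msuppXP <-; rewrite mdegMn mdeg1.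
Qed.

(** * Homogeneous components and the individual squares *)

Lemma mcoeff_pihomog d (p : P4) m :
  (pihomog mdeg d p)@_m = if mdeg m == d then p@_m else 0.
Proof.
rewrite pihomogE (raddf_sum (mcoeff m)) /=.
under eq_bigr do rewrite mcoeffZ mcoeffX.
case: ifP => H; last first.
  apply: big1 => n /eqP Hn; case: eqP => [E|_]; last by rewrite mulr0.
  by move: H; rewrite -E Hn eqxx.
rewrite [in RHS](mpolyE p) (raddf_sum (mcoeff m)) /= big_mkcond /=.
apply: eq_bigr => n _; rewrite mcoeffZ mcoeffX.
by case: (n =P m) => [->|_]; rewrite ?H ?mulr0 ?if_same.
Qed.

Lemma msupp_Sq_total_homog k p n : p \is k.-homog ->
  n \in msupp (Sq_total p - p) -> (k < mdeg n)%N.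
Proof.
move=> /dhomogP Hp; rewrite [in X in X - _](mpolyE p) [in X in _ - X](mpolyE p) Sq_total_sum -sumrB /=.
move/msupp_sum_le/flattenP => [ms /mapP[m]]; rewrite filter_predT => Hm ->.
rewrite Sq_totalZ -scalerBr /= => /msuppZ_le /approx_Sq_total.
by rewrite (Hp m Hm).
Qed.

Lemma pihomog_eq0 d (p : P4) :
  (forall n, n \in msupp p -> mdeg n <> d) -> pihomog mdeg d p = 0.
Proof.
move=> H; apply/mpolyP=> n; rewrite mcoeff_pihomog mcoeff0; case: eqP => // E.
by apply: memN_msupp_eq0; apply/negP => /H.
Qed.

Lemma pihomog_Sq_total_same k p : p \is k.-homog ->
  pihomog mdeg k (Sq_total p) = p.
Proof.
move=> Hp; rewrite -[Sq_total p](subrK p) pihomogD (pihomog_dE Hp).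
rewrite pihomog_eq0 ?add0r // => n /(msupp_Sq_total_homog Hp) /=; lia.
Qed.

Lemma pihomog_Sq_total_lt e k p : p \is k.-homog -> (e < k)%N ->
  pihomog mdeg e (Sq_total p) = 0.
Proof.
move=> Hp ek; rewrite -[Sq_total p](subrK p) pihomogD.
rewrite (pihomog_ne0 _ Hp) ?addr0 ?gtn_eqF //.
rewrite pihomog_eq0 // => n /(msupp_Sq_total_homog Hp) /=; lia.
Qed.

Lemma Sq_homog k r p : p \is k.-homog ->
  Sq r p = pihomog mdeg (k + r) (Sq_total p).
Proof.
move=> Hp; rewrite /Sq.
case: (altP (p =P 0)) => [->|p0]; first by rewrite msize0 big_ord0 !linear0.
have kp : (k < msize p)%N.
  rewrite -(mlead_deg p0) ltnS; move/dhomogP: Hp => /(_ _ (mlead_supp p0)) /= ->.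
  by [].
rewrite (bigD1 (Ordinal kp)) //= big1 ?addr0 ?(pihomog_dE Hp) // => j jk.
have -> : pihomog mdeg j p = 0.
  apply: pihomog_ne0 Hp.
  by apply: contraNneq jk => E; apply/eqP/val_inj.
by rewrite Sq_total0 pihomog0.
Qed.

Lemma Sq_is_homog k r p : p \is k.-homog -> Sq r p \is (k + r).-homog.
Proof. by move=> Hp; rewrite (Sq_homog r Hp); exact: pihomogP. Qed.

Lemma Sq_lin k r c p q : p \is k.-homog -> q \is k.-homog ->
  Sq r (c *: p + q) = c *: Sq r p + Sq r q.
Proof.
move=> Hp Hq; rewrite (Sq_homog r Hp) (Sq_homog r Hq).
rewrite (Sq_homog (k := k)) ?rpredD ?rpredZ //.
by rewrite Sq_totalD Sq_totalZ; exact: pihomog_is_linear.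
Qed.

Lemma msym_Sq k r s p : p \is k.-homog -> msym s (Sq r p) = Sq r (msym s p).
Proof.
move=> Hp; have Hs : msym s p \is k.-homog.
  by rewrite homog_piE -msym_pihomog pihomog_dE.
by rewrite (Sq_homog r Hp) (Sq_homog r Hs) msym_pihomog msym_Sq_total.
Qed.

Lemma msym_homog k s (p : P4) : p \is k.-homog -> msym s p \is k.-homog.
Proof. by move=> Hp; rewrite homog_piE -msym_pihomog pihomog_dE. Qed.

(** * Hit elements of B(4) *)

Lemma gradedB4 d p :
  reflect (p \is @symmetric 4 'F_2 /\ p \is d.-homog) (p \in graded B4 d).
Proof. exact: andP. Qed.

Lemma hit_deg_homog M d p : hit_deg M d p -> p \is d.-homog.
Proof.
move=> [f Hf ->]; rewrite big_nat_cond rpred_sum // => r.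
rewrite andbT ltnS => rd; have /andP[_ /= /(Sq_is_homog r)] := Hf r rd.
by rewrite subnK //; case/andP: rd.
Qed.

Lemma hit_deg0 d : hit_deg B4 d 0.
Proof.
exists (fun=> 0) => [r _|].
  by apply/gradedB4; split; [exact: rpred0 | exact: dhomog0].
by rewrite big1 // => r _; rewrite (Sq_homog r (dhomog0 _ _ 0)) Sq_total0 pihomog0.
Qed.

Lemma hit_deg_lin d c p q :
  hit_deg B4 d p -> hit_deg B4 d q -> hit_deg B4 d (c *: p + q).
Proof.
move=> [f Hf ->] [g Hg ->]; exists (fun r => c *: f r + g r) => [r rd|].
  have /gradedB4[fs fh] := Hf r rd; have /gradedB4[gs gh] := Hg r rd.
  by apply/gradedB4; rewrite !rpredD ?rpredZ.
rewrite scaler_sumr -big_split [LHS]big_nat_cond [RHS]big_nat_cond.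
apply: eq_bigr => r; rewrite andbT ltnS => rd.
have /gradedB4[_ fh] := Hf r rd; have /gradedB4[_ gh] := Hg r rd.
by rewrite (Sq_lin r c fh gh).
Qed.

Lemma hit_degD d p q : hit_deg B4 d p -> hit_deg B4 d q -> hit_deg B4 d (p + q).
Proof. by move=> /(hit_deg_lin 1) H /H; rewrite scale1r. Qed.

Lemma hit_degZ d c p : hit_deg B4 d p -> hit_deg B4 d (c *: p).
Proof. by move=> H; rewrite -[c *: p]addr0; apply: hit_deg_lin => //; exact: hit_deg0. Qed.

Lemma hit_deg_sum d (I : eqType) (r : seq I) (F : I -> P4) :
  (forall i, i \in r -> hit_deg B4 d (F i)) -> hit_deg B4 d (\sum_(i <- r) F i).
Proof.
move=> H; rewrite big_seq; elim/big_ind: _ => //; [exact: hit_deg0 | exact: hit_degD].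
Qed.

(** Passes from indexing by the source degree [i] to indexing by the degree r = d - i of the square;
    the subtracted term is r = 0. *)
Lemma sum_below_top (V : zmodType) (F : nat -> V) d k : (d < k)%N ->
  (forall i, (d < i)%N -> F i = 0) ->
  \sum_(i < k) F i - F d = \sum_(1 <= r < d.+1) F (d - r)%N.
Proof.
move=> dk F0; rewrite -(big_mkord predT).
rewrite (big_cat_nat_idem _ (n := d.+1)) //=; last exact: addr0.
rewrite [X in _ + X - _]big1_seq ?addr0; last first.
  by move=> i /andP[_]; rewrite mem_index_iota => /andP[/F0].
rewrite big_nat_recr //= addrK big_nat_rev /= add0n [RHS]big_add1 /=.
by apply: eq_bigr.
Qed.

(** The degree-d part of Sq(Psi) collects Sq^r of the component of degree d - r for all r >= 0, and
    Sq^0 is the identity. Components of a symmetric polynomial are symmetric, so the terms with r >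
    0 are hit in B(4). *)
Lemma hit_deg_Sq_total d (Psi : P4) : Psi \is @symmetric 4 'F_2 ->
  hit_deg B4 d (pihomog mdeg d (Sq_total Psi) - pihomog mdeg d Psi).
Proof.
move=> HP; exists (fun r => pihomog mdeg (d - r) Psi) => [r _|].
  by apply/gradedB4; split; [exact: pihomog_sym | exact: pihomogP].
pose F i := pihomog mdeg d (Sq_total (pihomog mdeg i Psi)).
(* The bound exceeds every degree in [Psi], and also [d], so that the term to be split off is
   present. *)
pose k := maxn (msize Psi) d.+1.
have FPsi : pihomog mdeg d (Sq_total Psi) = \sum_(i < k) F i.
  have E := @pihomog_partitionE 4 'F_2 mdeg k Psi (leq_maxl _ _).
  by rewrite [in LHS]E Sq_total_sum (raddf_sum (pihomog mdeg d)).
have Fd : pihomog mdeg d Psi = F d.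
  by rewrite /F (pihomog_Sq_total_same (pihomogP mdeg d Psi)).
rewrite FPsi Fd sum_below_top; last 2 first.
- by rewrite leq_max leqnn orbT.
- by move=> i di; exact: pihomog_Sq_total_lt (pihomogP _ _ _) di.
rewrite [LHS]big_nat_cond [RHS]big_nat_cond.
apply: eq_bigr => r; rewrite andbT => /andP[_ rd].
have := Sq_homog r (pihomogP mdeg (d - r)%N Psi); rewrite (subnK (n := d)) => [E|].
  exact: esym E.
by move: rd; rewrite ltnS.
Qed.

(** * Orbits of blocks and orbit sums *)

Definition block_orbit (F : block) : seq block :=
  undup [seq permute_block F s | s : 'S_4].

Lemma block_orbitP F G : reflect (exists s, G = permute_block F s) (G \in block_orbit F).
Proof.
rewrite mem_undup; apply: (iffP imageP) => [[s _ ->]|[s ->]]; first by exists s.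
by exists s.
Qed.

Lemma permute_blockM F s t :
  permute_block (permute_block F s) t = permute_block F (t * s)%g.
Proof. by apply/mnmP => i; rewrite !mnmE permM. Qed.

Lemma permute_block1 F : permute_block F 1%g = F.
Proof. by apply/mnmP => i; rewrite !mnmE perm1. Qed.

Lemma permute_block_inj s : injective (permute_block^~ s).
Proof.
apply: (can_inj (g := permute_block^~ s^-1%g)) => F.
by rewrite permute_blockM mulVg permute_block1.
Qed.

Lemma orbit_refl F : F \in block_orbit F.
Proof. by apply/block_orbitP; exists 1%g; rewrite permute_block1. Qed.

Lemma mem_orbit_permute F G s : (permute_block G s \in block_orbit F) = (G \in block_orbit F).
Proof.
apply/block_orbitP/block_orbitP => [] [t Et].
  exists (s^-1 * t)%g; rewrite -permute_blockM -Et permute_blockM.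
  by rewrite mulVg permute_block1.
by exists (s * t)%g; rewrite -permute_blockM Et.
Qed.

Lemma orbit_permute F s : perm_eq [seq permute_block G s | G <- block_orbit F] (block_orbit F).
Proof.
apply: uniq_perm; rewrite ?map_inj_uniq ?undup_uniq //; first exact: permute_block_inj.
move=> G; apply/mapP/idP => [[H HH ->]|HG]; first by rewrite mem_orbit_permute.
exists (permute_block G s^-1%g); first by rewrite mem_orbit_permute.
by rewrite permute_blockM mulgV permute_block1.
Qed.

(** A permutation only reorders the orbit. The equivariant family is arbitrary so that both the
    monomials and the polynomials [Psi] below are covered. *)
Lemma orbit_sum_symmetric (Phi : block -> P4) F :
  (forall G s, msym s (Phi G) = Phi (permute_block G s^-1%g)) ->
  \sum_(G <- block_orbit F) Phi G \is @symmetric 4 'F_2.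
Proof.
move=> H; apply/issymP => s; rewrite msym_sum.
rewrite -[RHS](perm_big _ (orbit_permute F s^-1%g)) big_map.
by apply: eq_bigr => G _; exact: H.
Qed.

Lemma msymX_block G s : msym s ('X_[G] : P4) = 'X_[permute_block G s^-1%g].
Proof. exact: msymX. Qed.

Lemma symmetric_orbit_sum F : orbit_sum F \is @symmetric 4 'F_2.
Proof. exact: orbit_sum_symmetric msymX_block. Qed.

Lemma mdeg_permute F s : mdeg (permute_block F s) = mdeg F.
Proof. exact: mdeg_mperm. Qed.

Lemma mcoeff_orbit_sum F m : (orbit_sum F)@_m = (m \in block_orbit F)%:R.
Proof.
rewrite /orbit_sum (raddf_sum (mcoeff m)) -/(block_orbit F) /=.
under eq_bigr do rewrite mcoeffX.
case: (boolP (m \in block_orbit F)) => Hm; last first.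
  by rewrite big1_seq // => G /andP[_ HG]; case: eqP => // E; rewrite -E HG in Hm.
rewrite (bigD1_seq m) ?undup_uniq //= eqxx big1 ?addr0 // => G.
by move/negbTE => ->.
Qed.

(** Coefficients are constant on orbits, so subtracting a multiple of the orbit sum of the leading
    monomial removes a whole orbit and creates no new monomial; induct on the size of the
    support. *)
Lemma hit_deg_symmetric_supp d (p : P4) : p \is @symmetric 4 'F_2 ->
  (forall G, G \in msupp p -> hit_deg B4 d (orbit_sum G)) -> hit_deg B4 d p.
Proof.
have [n] := ubnP (size (msupp p)); elim: n p => // n IH p size_p symp Hp.
case: (altP (p =P 0)) => [->|p0]; first exact: hit_deg0.
have HG := mlead_supp p0; set G := mlead p in HG.
pose q := p - p@_G *: orbit_sum G.
have sym_coef m : m \in block_orbit G -> p@_m = p@_G.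
  by case/block_orbitP => s ->; exact: msym_coeff.
have coef_q m : q@_m = if m \in block_orbit G then 0 else p@_m.
  rewrite mcoeffB mcoeffZ mcoeff_orbit_sum.
  by case: ifP => Hm; rewrite ?mulr1 ?mulr0 ?subr0 // sym_coef // subrr.
have sub : {subset msupp q <= msupp p}.
  by move=> m; rewrite !mcoeff_msupp coef_q; case: ifP; rewrite ?eqxx.
have -> : p = p@_G *: orbit_sum G + q by rewrite addrC subrK.
apply: hit_deg_lin; first exact: Hp.
apply: IH => [||m /sub]; last exact: Hp.
  rewrite -ltnS; apply: leq_trans size_p; rewrite ltnS.
  apply: (uniq_leq_size (s1 := G :: msupp q)) => [|m].
    by rewrite /= msupp_uniq mcoeff_msupp coef_q orbit_refl eqxx.
  by rewrite inE => /predU1P[->|/sub].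
by rewrite rpredB // rpredZ // symmetric_orbit_sum.
Qed.

(** * Binary digits and comparison of weights *)

Lemma bit0 a : bit a 0 = odd a.
Proof. by rewrite /bit expn0 divn1. Qed.

Lemma bitS a j : bit a j.+1 = bit a./2 j.
Proof. by rewrite /bit expnS divnMA divn2. Qed.

(* The exponents e of the monomials x^e that may occur in [psi N s g x] below. *)
Fixpoint reach (s g e : nat) : Prop :=
  match s with
  | 0 => exists j, e = (odd g * 2 ^ j + g./2)%N
  | s'.+1 => exists j e', e = (odd g * 2 ^ j + e'.*2)%N /\ reach s' g./2 e'
  end.

Definition weight (a : 'I_4 -> nat) (j : nat) : nat := (\sum_(i < 4) bit (a i) j)%N.

(** Induct on [s]. For positive [s] the part of [b i] coming from higher digits is even, so moving a
    digit out of column 0 lowers the weight there; if none moves, column 0 agrees and halving passes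
    to the next column. At [s = 0] equality of degrees is exactly the identity excluded by the last
    hypothesis. *)
Lemma reach_weight s (a b : 'I_4 -> nat) :
  (forall i, reach s (a i) (b i)) ->
  (\sum_i b i = \sum_i a i)%N ->
  (forall J : 'I_4 -> nat,
     \sum_i bit (a i) s * 2 ^ J i <> \sum_i (bit (a i) s + a i %/ 2 ^ s.+1))%N ->
  lex_lt (weight b) (weight a).
Proof.
elim: s a b => [|s IH] a b Hr Hd HJ.
  have [J HJe] := fin_all_exists Hr.
  case: (HJ J); move: Hd; rewrite (eq_bigr _ (fun i _ => HJe i)).
  rewrite big_split /= => E.
  have E2 : (\sum_i a i = \sum_i odd (a i) + \sum_i (a i)./2 + \sum_i (a i)./2)%N.
    rewrite -!big_split /=; apply: eq_bigr => i _.
    by rewrite -{1}(odd_double_half (a i)) -addnn addnA.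
  under eq_bigr do rewrite bit0.
  under [in RHS]eq_bigr do rewrite bit0 expn1 divn2.
  by rewrite big_split /=; move: E; rewrite E2 => /addIn.
have [J HJe] := fin_all_exists Hr.
have [c Hc] := fin_all_exists HJe.
have bE i : b i = (odd (a i) * 2 ^ J i + (c i).*2)%N by case: (Hc i).
have cR i : reach s (a i)./2 (c i) by case: (Hc i).
case: (altP (@forallP _ (fun i => odd (a i) ==> (J i == 0)%N))) => HA.
  have bE' i : b i = (odd (a i) + (c i).*2)%N.
    by rewrite bE; have := HA i; case: odd => //= /eqP ->.
  have [k klt kS] : lex_lt (weight c) (weight (fun i => (a i)./2)).
    apply: (IH _ _ cR).
      have Eb : (\sum_i b i = \sum_i odd (a i) + (\sum_i c i) * 2)%N.
        by rewrite big_distrl -big_split; apply: eq_bigr => i _ /=; rewrite bE' muln2.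
      have Ea : (\sum_i a i = \sum_i odd (a i) + (\sum_i (a i)./2) * 2)%N.
        rewrite big_distrl -big_split; apply: eq_bigr => i _ /=.
        by rewrite muln2 odd_double_half.
      by move: Hd; rewrite Eb Ea => /addnI /eqP; rewrite eqn_pmul2r // => /eqP.
    move=> J' EJ'; apply: (HJ J').
    under eq_bigr do rewrite bitS.
    under [in RHS]eq_bigr do rewrite bitS expnS divnMA divn2.
    exact: EJ'.
  have halfE i : (b i)./2 = c i by rewrite bE' half_bit_double.
  exists k.+1 => [[|j] jk|].
  - rewrite /weight; apply: eq_bigr => i _; rewrite !bit0 bE' oddD odd_double addbF.
    by rewrite oddb.
  - have := klt j jk; rewrite /weight => E.
    under eq_bigr do rewrite bitS halfE.
    by under [in RHS]eq_bigr do rewrite bitS.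
  - move: kS; rewrite /weight => E.
    under eq_bigr do rewrite bitS halfE.
    by under [X in (_ < X)%N]eq_bigr do rewrite bitS.
exists 0%N => //; rewrite /weight.
move: HA; rewrite negb_forall => /existsP[i0]; rewrite negb_imply => /andP[ai0 Ji0].
have odd_b i : odd (b i) = odd (a i) && (J i == 0)%N.
  by rewrite bE oddD odd_double addbF oddM oddb oddX orbF.
rewrite (bigD1 i0) //= [X in (_ < X)%N](bigD1 i0) //= !bit0 odd_b ai0 (negbTE Ji0) /=.
rewrite add0n add1n ltnS; apply: leq_sum => i _; rewrite !bit0 odd_b.
by case: odd; case: eqP.
Qed.

(** * The polynomials [psi] and [Psi] and their total squares *)

Definition Lsum (N : nat) (x : P4) : P4 := \sum_(j < N) x ^+ (2 ^ j).

(* With L = x + x^2 + x^4 + ..., each factor x^(2^t), t <= s, of x^g becomes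
   L^(2^t), and the remaining factor x^(2^(s+1) q) becomes its square root. *)
Fixpoint psi (N s g : nat) (x : P4) : P4 :=
  (if odd g then Lsum N x else 1) *
  (if s is s'.+1 then psi N s' g./2 x ^+ 2 else x ^+ g./2).

Lemma msym_psi t N s g x : msym t (psi N s g x) = psi N s g (msym t x).
Proof.
have HL : msym t (Lsum N x) = Lsum N (msym t x).
  by rewrite /Lsum msym_sum; apply: eq_bigr => j _; exact: msymXn.
elim: s g => [|s IH] g /=; rewrite msymM msymXn ?IH.
all: by case: odd; rewrite ?HL ?msym1.
Qed.

(** Squaring is the Frobenius map, hence additive: cross terms vanish. *)
Lemma mpoly_sqr_supp (p : P4) m : m \in msupp (p ^+ 2) ->
  exists2 n, n \in msupp p & m = (n *+ 2)%MM.
Proof.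
have -> : p ^+ 2 = \sum_(n <- msupp p) (p@_n *: 'X_[n]) ^+ 2.
  have E : pFrobenius_aut P4_pchar2 p = p ^+ 2 by [].
  rewrite -E [in LHS](mpolyE p) (raddf_sum (pFrobenius_aut P4_pchar2)).
  exact: eq_bigr.
move/msupp_sum_le/flattenP => [ms /mapP[n]]; rewrite filter_predT => Hn ->.
rewrite exprZn mpolyXn => /msuppZ_le /mem_msuppXP <-; by exists n.
Qed.

Lemma Lsum_supp N i m : m \in msupp (Lsum N 'X_i) ->
  exists j, m = (U_(i) *+ 2 ^ j)%MM.
Proof.
move/msupp_sum_le/flattenP => [ms /mapP[j _ ->]].
by rewrite mpolyXn => /mem_msuppXP <-; exists j.
Qed.

Lemma mnm_mulnD (i : 'I_4) a b : (U_(i) *+ a + U_(i) *+ b)%MM = (U_(i) *+ (a + b))%MM.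
Proof. by apply/mnmP => k; rewrite mnmDE !mulmnE mulnDr. Qed.

Lemma psi_supp N s g i m : m \in msupp (psi N s g 'X_i) ->
  exists2 e, m = (U_(i) *+ e)%MM & reach s g e.
Proof.
have Hodd h n : n \in msupp (if odd h then Lsum N 'X_i else 1) ->
    exists j, n = (U_(i) *+ (odd h * 2 ^ j))%MM.
  case: odd => [/Lsum_supp[j ->]|]; first by exists j; rewrite mul1n.
  by rewrite msupp1 inE => /eqP ->; exists 0%N.
elim: s g m => [|s IH] g m /= /msuppM_ex[m1 [m2 [/Hodd[j ->] H2 ->]]].
  move: H2; rewrite mpolyXn => /mem_msuppXP <-; rewrite mnm_mulnD.
  by eexists; [reflexivity | exists j].
have [n /IH[e -> Hr] ->] := mpoly_sqr_supp H2.
have -> : (U_(i) *+ e *+ 2 = U_(i) *+ e.*2)%MM.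
  by apply/mnmP => k; rewrite !mulmnE -mulnA muln2.
by rewrite mnm_mulnD; eexists; [reflexivity | exists j, e].
Qed.

Lemma expr2nD (x y : P4) k : (x + y) ^+ (2 ^ k) = x ^+ (2 ^ k) + y ^+ (2 ^ k).
Proof.
apply: exprDn_pchar; rewrite pnatX; apply/orP; left.
by rewrite pnatE //; exact: P4_pchar2.
Qed.

(** Each x^(2^j) is sent to x^(2^j) + x^(2^(j+1)), so the sum telescopes in characteristic 2. *)
Lemma Sq_total_Lsum N i : Sq_total (Lsum N 'X_i) = 'X_i + 'X_i ^+ (2 ^ N).
Proof.
rewrite /Lsum Sq_total_sum.
under eq_bigr do rewrite Sq_totalXn Sq_totalX expr2nD -exprM -expnS.
elim: N => [|N IH].
  rewrite big_ord0 expn0 expr1; exact/esym/(addrr_pchar2 P4_pchar2).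
rewrite big_ord_recr IH /= addrA; congr (_ + _).
rewrite -addrA (addrr_pchar2 P4_pchar2); exact: addr0.
Qed.

(** Errors above [D] come from the tail x^(2^N) of Sq(L), errors below [a] from the square root,
    where x + x^2 stands for x^2. When [a = D] neither kind meets degree [a]. *)
Definition near (D a b : nat) : bool := (b < a)%N || (D < b)%N.

Lemma near_additive D : additive_rel (near D).
Proof. by rewrite /near; split=> *; lia. Qed.

Lemma approx_Sq_psi D N s g i : (D < 2 ^ N)%N ->
  approx (near D) (U_(i) *+ g)%MM (Sq_total (psi N s g 'X_i)).
Proof.
move=> DN; have HA := near_additive D.
have Hodd h : approx (near D) (U_(i) *+ odd h)%MM
    (Sq_total (if odd h then Lsum N 'X_i else 1)).
  case: odd => n; last by rewrite mulm0n Sq_total1; exact: approx1.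
  rewrite mulm1n Sq_total_Lsum addrAC subrr add0r mpolyXn => /mem_msuppXP <-.
  by rewrite /near mdegMn mdeg1 mul1n DN orbT.
have Hg h : (U_(i) *+ h = U_(i) *+ odd h + U_(i) *+ (h./2).*2)%MM.
  by rewrite mnm_mulnD odd_double_half.
have H2 h : (U_(i) *+ h.*2 = U_(i) *+ h *+ 2)%MM.
  by apply/mnmP => k; rewrite !mulmnE -mulnA muln2.
elim: s g => [|s IH] g /=; rewrite Sq_totalM Sq_totalXn Hg; apply: approxM => //.
  have -> : (U_(i) *+ g./2.*2 = U_(i) *+ 2 *+ g./2)%MM.
    by apply/mnmP => k; rewrite !mulmnE -mulnA mul2n.
  apply: approx_exp => // n; rewrite Sq_totalX -mpolyXn addrK.
  by move/mem_msuppXP <-; rewrite /near mdegMn mdeg1.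
by rewrite H2; exact: approx_exp.
Qed.

Definition Psi (N s : nat) (F : block) : P4 := \prod_i psi N s (F i) 'X_i.

Lemma msym_Psi N s F t : msym t (Psi N s F) = Psi N s (permute_block F t^-1%g).
Proof.
rewrite /Psi msym_prod [RHS](reindex_inj (@perm_inj _ t)) /=.
apply: eq_bigr => i _; rewrite msym_psi msymXU mnmE permK; reflexivity.
Qed.

Lemma Psi_supp N s F m : m \in msupp (Psi N s F) -> forall i, reach s (F i) (m i).
Proof.
rewrite /Psi => Hm i.
(* Generalized to partial products: variables outside [r] do not occur, so the exponent of each
   variable comes from its own factor alone. *)
suff H r : uniq r -> m \in msupp (\prod_(i <- r) psi N s (F i) 'X_i) ->
    forall i, if i \in r then reach s (F i) (m i) else m i = 0%N.
  by have := H _ (index_enum_uniq _) Hm i; rewrite mem_index_enum.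
elim: r m {Hm i} => [|i r IH] m /=.
  by rewrite big_nil msupp1 inE => _ /eqP -> i; rewrite mnm0E.
move=> /andP[ir ur]; rewrite big_cons.
move=> /msuppM_ex[m1 [m2 [/psi_supp[e -> He] /(IH _ ur) H2 ->]]] k.
have := H2 k; rewrite mnmDE mulmnE mnm1E inE (eq_sym k).
case: (i =P k) => [<-|_] /=; last by rewrite mul0n.
by rewrite (negbTE ir) => ->; rewrite mul1n addn0.
Qed.

Lemma Psi_top d N s F : (d < 2 ^ N)%N -> mdeg F = d ->
  pihomog mdeg d (Sq_total (Psi N s F)) = 'X_[F].
Proof.
move=> dN Fd.
have H : approx (near d) F (Sq_total (Psi N s F)).
  rewrite {1}(multinomUE_id F) /Psi Sq_total_prod.
  by apply: approx_prod => [|i]; [exact: near_additive | exact: approx_Sq_psi].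
rewrite -[Sq_total _](subrK 'X_[F]) pihomogD pihomog_eq0 => [|n /H].
  by rewrite add0r pihomogX /= Fd eqxx.
by move=> /= H1 E; move: H1; rewrite /near E Fd ltnn.
Qed.

(** * Reducing an orbit sum to smaller weight sequences *)

Lemma omega_permute F s : omega (permute_block F s) =1 omega F.
Proof.
move=> j; rewrite /omega [RHS](reindex_inj (@perm_inj _ s)).
by apply: eq_bigr => i _; rewrite mnmE.
Qed.

Lemma lex_lt_eqr u v v' : v =1 v' -> lex_lt u v -> lex_lt u v'.
Proof.
by move=> E [k Hk kk]; exists k => [j /Hk ->|]; rewrite -E.
Qed.

(* By the hypothesis on J, no degree-d monomial of [Psi d s F] agrees with F in
   all the columns below s. *)
Lemma orbit_sum_hit_mod_lower d s (F : block) : mdeg F = d ->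
  (forall J : 'I_4 -> nat,
     \sum_i bit (F i) s * 2 ^ J i <> \sum_i (bit (F i) s + F i %/ 2 ^ s.+1))%N ->
  (forall G, mdeg G = d -> lex_lt (omega G) (omega F) ->
     hit_deg B4 d (orbit_sum G)) ->
  hit_deg B4 d (orbit_sum F).
Proof.
move=> Fd HJ Hlow.
pose Phi := \sum_(G <- block_orbit F) Psi d s G.
have symPhi : Phi \is @symmetric 4 'F_2.
  by apply: orbit_sum_symmetric => G t; exact: msym_Psi.
have topPhi : pihomog mdeg d (Sq_total Phi) = orbit_sum F.
  rewrite /Phi Sq_total_sum (raddf_sum (pihomog mdeg d)) /=.
  (* The length [N = d] of L suffices because d < 2^d. *)
  apply: eq_big_seq => G /block_orbitP[t ->]; apply: Psi_top; first exact: ltn_expl.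
  by rewrite mdeg_permute.
have := hit_deg_Sq_total d symPhi; rewrite topPhi => H.
rewrite -[orbit_sum F](subrK (pihomog mdeg d Phi)); apply: hit_degD => //.
apply: hit_deg_symmetric_supp; first exact: pihomog_sym.
move=> G; rewrite mcoeff_msupp mcoeff_pihomog; case: (mdeg G =P d) => [Gd|]; last by rewrite eqxx.
rewrite -mcoeff_msupp => /msupp_sum_le/flattenP[ms /mapP[H']].
rewrite filter_predT => /block_orbitP[t ->] -> /Psi_supp HG.
apply: Hlow => //; apply: lex_lt_eqr (omega_permute F t) _.
apply: (reach_weight HG).
  by rewrite -!mdegE Gd mdeg_permute.
(* The monomial comes from a permuted block; the excluded identity is symmetric in the rows, so its
   exponents are carried back along [t]. *)
move=> J EJ; apply: (HJ (fun i => J (t^-1%g i))).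
rewrite [LHS](reindex_inj (@perm_inj _ t)) [RHS](reindex_inj (@perm_inj _ t)).
under eq_bigr do rewrite permK.
rewrite (eq_bigr (fun i => bit (permute_block F t i) s * 2 ^ J i)%N); last first.
  by move=> i _; rewrite mnmE.
by rewrite EJ; apply: eq_bigr => i _; rewrite mnmE.
Qed.

(** * Spikes and the arithmetic obstructions *)

Lemma divn_bit a s : (a %/ 2 ^ s = bit a s + 2 * (a %/ 2 ^ s.+1))%N.
Proof. by rewrite /bit expnSr divnMA divn2 mul2n odd_double_half. Qed.

Lemma weight_decomposition (a : 'I_4 -> nat) s :
  (\sum_i a i = \sum_(u < s) 2 ^ u * weight a u + 2 ^ s * \sum_i a i %/ 2 ^ s)%N.
Proof.
elim: s => [|s IH].
  by rewrite big_ord0 add0n mul1n; apply: eq_bigr => i _; rewrite divn1.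
rewrite IH [in RHS]big_ord_recr /= -addnA; congr addn.
under eq_bigr do rewrite divn_bit.
by rewrite big_split -big_distrr mulnDr mulnA -expnSr.
Qed.

Lemma half_spike r : ((2 ^ r.+1 - 1)./2 = 2 ^ r - 1)%N.
Proof.
have -> : (2 ^ r.+1 - 1 = true + (2 ^ r - 1).*2)%N.
  by have := expn_gt0 2 r; rewrite expnS -mul2n; lia.
exact: half_bit_double.
Qed.

Lemma bit_spike r u : bit (2 ^ r - 1) u = (u < r)%N.
Proof.
elim: u r => [|u IH] [|r]; first by rewrite bit0.
- rewrite bit0 oddB ?expn_gt0 //.
  by rewrite oddX.
- by rewrite /bit div0n.
by rewrite bitS half_spike IH.
Qed.

Lemma div_spike r s : ((2 ^ r - 1) %/ 2 ^ s = 2 ^ (r - s) - 1)%N.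
Proof.
elim: s r => [|s IH] [|r]; rewrite ?divn1 ?subn0 ?div0n //.
by rewrite [(2 ^ s.+1)%N]expnS divnMA divn2 half_spike IH subSS.
Qed.

(** The rows with positive [r i], at most four of them, write the degree as a sum of that many
    numbers 2^r - 1. *)
Lemma spike_mu Z : spike Z -> (mu (mdeg Z) <= 4)%N.
Proof.
move=> /fin_all_exists[r HZ]; set d := mdeg Z.
pose A := [set i | (0 < r i)%N].
(* Puts the exponents in the finite range over which [spike_sum] searches. *)
have rd i : (r i <= d)%N.
  have : (r i <= Z i)%N by rewrite HZ; have := ltn_expl (r i) (ltnSn 1); lia.
  by move/leq_trans; apply; rewrite /d mdegE (bigD1 i) //= leq_addr.
rewrite /mu; case: ex_minnP => m _ Hmin.
apply: (@leq_trans #|A|); last by have := max_card (mem A); rewrite card_ord.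
apply: Hmin; apply/existsP; exists [ffun n => inord (r (enum_val n))].
apply/andP; split.
  apply/forallP => n; rewrite ffunE inordK ?ltnS //.
  by have := enum_valP n; rewrite inE.
under eq_bigr do rewrite ffunE inordK ?ltnS //.
rewrite -(big_enum_val (fun i => 2 ^ r i - 1)%N) /d mdegE.
rewrite [X in X == _](bigID (mem A)) /= [X in (_ + X)%N]big1 ?addn0 => [|i].
  by apply/eqP; apply: eq_bigr => i _; exact: HZ.
by rewrite inE HZ -leqNgt leqn0 => /eqP ->.
Qed.

(** Double the identity and subtract the number of ones in column [s]. The result writes the part of
    the degree from column [s] on as a sum of numbers 2^k - 1, which is how a spike arises. *)
Lemma sum_pow2_to_spike (F : block) s (J : 'I_4 -> nat) :
  (\sum_i bit (F i) s * 2 ^ J i = \sum_i (bit (F i) s + F i %/ 2 ^ s.+1))%N ->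
  (\sum_i bit (F i) s * (2 ^ (J i).+1 - 1) = \sum_i F i %/ 2 ^ s)%N.
Proof.
move=> E; apply: (@addIn (\sum_i bit (F i) s)%N).
rewrite -!big_split /= (eq_bigr (fun i => 2 * (bit (F i) s * 2 ^ J i))%N); last first.
  by move=> i _; have := expn_gt0 2 (J i); rewrite expnS; case: bit; lia.
rewrite -big_distrr E big_distrr /=; apply: eq_bigr => i _.
by rewrite (divn_bit (F i) s); lia.
Qed.

(** At [s = 0] the identity would give a four-row spike of the degree of [F], supported on its odd
    rows. *)
Lemma mu_gt4_obstruction (F : block) (J : 'I_4 -> nat) : (4 < mu (mdeg F))%N ->
  (\sum_i bit (F i) 0 * 2 ^ J i <> \sum_i (bit (F i) 0 + F i %/ 2 ^ 1))%N.
Proof.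
rewrite ltnNge => /negP H /sum_pow2_to_spike E; apply: H.
pose Z : block := [multinom bit (F i) 0 * (2 ^ (J i).+1 - 1) | i < 4]%N.
have -> : mdeg F = mdeg Z.
  rewrite !mdegE; under [in RHS]eq_bigr do rewrite mnmE.
  by rewrite E; apply: eq_bigr => i _; rewrite divn1.
apply: spike_mu => i; rewrite mnmE; case: bit; last by exists 0%N.
by exists (J i).+1; rewrite mul1n.
Qed.

(* Otherwise, of the w_s > omega_s(F) rows of the minimal spike that are longer
   than s, we could refit omega_s(F) ones to the exponents J and cut the others
   to length s, which gives a spike of degree d with smaller weights. *)
Lemma min_spike_obstruction d w (F : block) s (J : 'I_4 -> nat) :
  is_omega_min d w -> mdeg F = d ->
  (forall j, (j < s)%N -> omega F j = w j) -> (omega F s < w s)%N ->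
  (\sum_i bit (F i) s * 2 ^ J i <> \sum_i (bit (F i) s + F i %/ 2 ^ s.+1))%N.
Proof.
move=> [[Z [/fin_all_exists[r HZ] Zd Zw]] Hmin] Fd Flow Fs /sum_pow2_to_spike E.
pose A := [set i | bit (F i) s]; pose S := [set i | (s < r i)%N].
have cardA : #|A| = omega F s.
  rewrite -sum1_card /omega big_mkcond /=; apply: eq_bigr => i _.
  by rewrite inE; case: bit.
have cardS : #|S| = w s.
  rewrite -Zw -sum1_card /omega big_mkcond /=; apply: eq_bigr => i _.
  by rewrite inE HZ bit_spike; case: ltnP.
have /card_geqP[ts [uts size_ts ts_sub]] : (#|A| <= #|S|)%N by rewrite cardA cardS ltnW.
have tsS i : i \in ts -> (s < r i)%N by move/ts_sub; rewrite inE.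
(* [g] matches the chosen spike rows [ts] with the rows of [F] having digit 1 in column [s]. The new
   length s + J + 1 is such that division of 2^(s+J+1) - 1 by 2^s leaves 2^(J+1) - 1. *)
pose g i := nth ord0 (enum A) (index i ts).
pose r' i := if i \in ts then (s + (J (g i)).+1)%N
             else if (s < r i)%N then s else r i.
pose Z' : block := [multinom (2 ^ r' i - 1)%N | i < 4].
have Z'E i : Z' i = (2 ^ r' i - 1)%N by rewrite mnmE.
have Z'low u : (u < s)%N -> omega Z' u = w u.
  move=> us; rewrite -Zw; apply: eq_bigr => i _; rewrite Z'E HZ !bit_spike /r'.
  case: ifP => [/tsS|_]; first by lia.
  by case: ifP; lia.
have Z's : omega Z' s = omega F s.
  rewrite -cardA -size_ts -sum1_size (big_uniq _ uts) /= /omega [RHS]big_mkcond /=.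
  apply: eq_bigr => i _; rewrite Z'E bit_spike /r'.
  case: ifP => [_|_]; first by lia.
  by case: ifP; lia.
apply: (Hmin Z').
- by move=> i; exists (r' i).
(* Split both degrees at column [s]: the lower columns have equal weights, and the quotients have
   equal sums by [E]. *)
- rewrite -Fd !mdegE (weight_decomposition Z' s) (weight_decomposition F s).
  congr addn.
    apply: eq_bigr => u _; congr muln.
    exact: etrans (Z'low u (ltn_ord u)) (esym (Flow u (ltn_ord u))).
  congr muln; rewrite -E.
  transitivity (\sum_(i in A) (2 ^ (J i).+1 - 1))%N; last first.
    by rewrite big_mkcond; apply: eq_bigr => i _; rewrite inE; case: bit; rewrite ?mul1n.
  transitivity (\sum_(i <- ts) (2 ^ (J (g i)).+1 - 1))%N.
    rewrite (big_uniq _ uts) /= [RHS]big_mkcond; apply: eq_bigr => i _.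
    rewrite Z'E div_spike /r'; case: ifP => [_|_]; first by rewrite addKn.
    by case: ifP => H; rewrite (_ : (_ - s = 0)%N) //; lia.
  rewrite -[RHS]big_enum /= (big_nth ord0) [RHS](big_nth ord0) -cardE size_ts.
  rewrite [LHS]big_nat_cond [RHS]big_nat_cond; apply: eq_bigr => n /andP[/andP[_ nA] _].
  by rewrite /g index_uniq // size_ts.
- by exists s; [exact: Z'low | rewrite Z's].
Qed.

(** * Induction over blocks of fixed degree, and the orders used *)

Lemma finite_induction (T : eqType) (lt : T -> T -> Prop) (P : T -> Prop) (r : seq T) :
  (forall x, ~ lt x x) ->
  (forall y x z, lt x y -> lt y z -> lt x z) ->
  (forall x, x \in r -> (forall y, y \in r -> lt y x -> P y) -> P x) ->
  forall x, x \in r -> P x.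
Proof.
move=> lt_irr lt_trans IHr.
(* [L] holds all predecessors of [x]. Passing to a predecessor [y] lets [y] be deleted from [L], by
   transitivity and irreflexivity. *)
suff H n (L : seq T) x : (size L <= n)%N -> x \in r ->
    (forall y, y \in r -> lt y x -> y \in L) -> P x.
  by move=> x xr; apply: (H _ r x (leqnn _) xr).
elim: n L x => [|n IH] L x Ln xr HL; apply: IHr => // y yr yx.
  by have := HL y yr yx; move: Ln; rewrite leqn0 size_eq0 => /eqP ->.
have yL := HL y yr yx.
apply: (IH [seq z <- L | z != y]) => // [|z zr zy].
  rewrite -ltnS; apply: leq_trans Ln.
  by rewrite size_filter -(count_predC (pred1 y) L) -add1n leq_add2r -has_count has_pred1.
rewrite mem_filter (HL z zr (lt_trans _ _ _ zy yx)) andbT.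
by apply/eqP => E; apply: (lt_irr y); rewrite -{1}E.
Qed.

(** The left lexicographic order on infinite sequences is not well founded, but only finitely many
    blocks have degree [d]. *)
Lemma block_induction d (lt : block -> block -> Prop) (P : block -> Prop) :
  (forall x, ~ lt x x) ->
  (forall y x z, lt x y -> lt y z -> lt x z) ->
  (forall F, mdeg F = d -> (forall G, mdeg G = d -> lt G F -> P G) -> P F) ->
  forall F, mdeg F = d -> P F.
Proof.
move=> lt_irr lt_trans IHd F Fd.
pose r := [seq bmnm m | m : 'X_{1..4 < d.+1}].
have memr (G : block) : mdeg G = d -> G \in r.
  move=> Gd; have H : (mdeg G < d.+1)%N by rewrite Gd.
  by apply/imageP; exists (BMultinom H).
suff H : forall G, G \in r -> mdeg G = d -> P G by exact: H (memr F Fd) Fd.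
apply: (finite_induction lt_irr lt_trans) => G _ H Gd.
by apply: IHd => // G' G'd lt_G'; exact: H (memr G' G'd) lt_G' G'd.
Qed.

Lemma lex_lt_irr u : ~ lex_lt u u.
Proof. by case=> k _; rewrite ltnn. Qed.

Lemma lex_lt_trans v u w : lex_lt u v -> lex_lt v w -> lex_lt u w.
Proof.
move=> [k Hk kk] [l Hl ll]; exists (minn k l).
  by move=> j; rewrite leq_min => /andP[jk jl]; rewrite Hk // Hl.
case: (ltngtP k l) => [kl|lk|kl].
- by rewrite -Hl.
- by rewrite Hk.
- by rewrite -kl in ll *; exact: ltn_trans kk ll.
Qed.

Lemma lex_lt_eql u u' v : u =1 u' -> lex_lt u v -> lex_lt u' v.
Proof. by move=> E [k Hk kk]; exists k => [j /Hk <-|]; rewrite -E. Qed.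

Lemma measure_lt_irr m : ~ measure_lt m m.
Proof. by case=> [|[_ [|[_]]]]; exact: lex_lt_irr. Qed.

Lemma measure_lt_trans m2 m1 m3 :
  measure_lt m1 m2 -> measure_lt m2 m3 -> measure_lt m1 m3.
Proof.
case=> [H|[E H]] [H'|[E' H']].
- by left; exact: lex_lt_trans H H'.
- by left; exact: lex_lt_eqr E' H.
- by left; apply: lex_lt_eql H' => j; rewrite E.
right; split; first exact: ftrans E E'.
case: H H' => [H|[F H]] [H'|[F' H']].
- by left; exact: lex_lt_trans H H'.
- by left; exact: lex_lt_eqr F' H.
- by left; apply: lex_lt_eql H' => j; rewrite F.
by right; split; [exact: ftrans F F' | exact: lex_lt_trans H H'].
Qed.

(** * Orbit sums that are hit without the descent hypothesis *)

Definition omega_lt (G F : block) := lex_lt (omega G) (omega F).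

(** A symmetric analogue of Wood's theorem: the obstruction at [s = 0] depends only on the degree,
    so the induction runs through all blocks of degree [d]. *)
Lemma orbit_sum_hit_mu_gt4 d F : (4 < mu d)%N -> mdeg F = d ->
  hit_deg B4 d (orbit_sum F).
Proof.
move=> mud; move: F; apply: (@block_induction d omega_lt).
- by move=> F; exact: lex_lt_irr.
- by move=> G F H; exact: lex_lt_trans.
move=> F Fd; apply: (orbit_sum_hit_mod_lower (s := 0)) => // J.
by apply: mu_gt4_obstruction; rewrite Fd.
Qed.

Lemma orbit_sum_hit_omega_lt d w F : is_omega_min d w -> mdeg F = d ->
  lex_lt (omega F) w -> hit_deg B4 d (orbit_sum F).
Proof.
move=> wmin; move: F; apply: (@block_induction d omega_lt).
- by move=> F; exact: lex_lt_irr.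
- by move=> G F H; exact: lex_lt_trans.
(* [s] is the first column where [omega F] drops below the minimal sequence; blocks of smaller
   weight stay below it by transitivity. *)
move=> F Fd IH Fw; have [s Hs ss] := Fw.
apply: (orbit_sum_hit_mod_lower (s := s)) => // [J|G Gd GF].
  exact: min_spike_obstruction wmin Fd Hs ss.
by apply: IH => //; exact: lex_lt_trans GF Fw.
Qed.

Lemma orbit_sum_hit_free d F : hit_deg P4full d 'X_[F] ->
  stabilizer F = [set 1%g] -> hit_deg B4 d (orbit_sum F).
Proof.
move=> [f Hf HF] stabF.
have Hh r : (1 <= r <= d)%N -> f r \is (d - r).-homog by move/Hf => /andP[].
have inj : injective (permute_block F).
  move=> s t E; have : (t^-1 * s)%g \in stabilizer F.
    by rewrite inE -permute_blockM E permute_blockM mulVg permute_block1.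
  by rewrite stabF inE => /eqP/(canRL (mulKVg _)); rewrite mulg1.
(* With trivial stabilizer the translates are pairwise distinct, so nothing cancels modulo 2. *)
have -> : orbit_sum F = \sum_(s : 'S_4) msym s 'X_[F].
  rewrite /orbit_sum undup_id; last by rewrite map_inj_uniq // enum_uniq.
  rewrite big_image /= (reindex_inj invg_inj) /=.
  by apply: eq_bigr => s _; rewrite msymX_block.
exists (fun r => \sum_(s : 'S_4) msym s (f r)) => [r rd|].
  apply/gradedB4; split; last first.
    by apply: rpred_sum => s _; exact/msym_homog/Hh.
  apply/issymP => t; rewrite msym_sum [RHS](reindex_inj (mulIg t)).
  by apply: eq_bigr => s _; rewrite msymMm.
rewrite HF; under eq_bigr do rewrite msym_sum.
rewrite exchange_big [LHS]big_nat_cond [RHS]big_nat_cond.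
apply: eq_bigr => r; rewrite andbT ltnS => rd.
have fh s : msym s (f r) \is (d - r).-homog by exact/msym_homog/Hh.
have sh : \sum_(s : 'S_4) msym s (f r) \is (d - r).-homog by exact: rpred_sum.
rewrite (Sq_homog r sh) Sq_total_sum (raddf_sum (pihomog mdeg _)).
apply: eq_bigr => s _; rewrite (msym_Sq r s (Hh r rd)); exact: Sq_homog (fh s).
Qed.

(** * Duality: detecting hit symmetric polynomials by functionals *)

Lemma submodule_vspace (L : fieldType) (V : vectType L) (S : V -> Prop) :
  S 0 -> (forall c u v, S u -> S v -> S (c *: u + v)) ->
  exists U : {vspace V}, forall v, S v <-> v \in U.
Proof.
move=> S0 Slin.
(* Induct on the codimension of a subspace [U] inside [S]: either [U] exhausts [S], or a vector of
   [S] outside [U] enlarges it. *)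
suff H n (U : {vspace V}) : (\dim {:V} - \dim U <= n)%N -> (forall v, v \in U -> S v) ->
    exists U : {vspace V}, forall v, S v <-> v \in U.
  by apply: (H _ 0%VS (leqnn _)) => v; rewrite memv0 => /eqP ->.
elim: n U => [|n IH] U Un SU.
  exists U => v; split=> [_|/SU //].
  have /eqP -> : U == {:V}%VS by rewrite eqEdim subvf -subn_eq0 -leqn0.
  exact: memvf.
case: (classic (exists2 v, S v & v \notin U)) => [[v Sv vU]|N]; last first.
  exists U => v; split=> [Sv|/SU //]; apply/negPn/negP => vU; apply: N.
  by exists v.
apply: (IH (<[v]> + U)%VS) => [|w].
  have : (\dim U < \dim (<[v]> + U))%N.
    rewrite ltnNge; apply: contra vU => H.
    have /eqP -> : U == (<[v]> + U)%VS by rewrite eqEdim addvSr.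
    exact: (subvP (addvSl _ _)) (memv_line v).
  by have := dimvS (subvf (<[v]> + U)%VS); lia.
case/memv_addP => _ /vlineP[c ->] [u uU ->]; apply: Slin => //; exact: SU.
Qed.

(** Compose the projection with kernel [U] with a coordinate that is nonzero on the image of [v]. *)
Lemma separating_functional (L : fieldType) (V : vectType L) (U : {vspace V}) v :
  v \notin U -> exists f : V -> L,
    [/\ forall c u w, f (c *: u + w) = c * f u + f w,
        forall u, u \in U -> f u = 0
      & f v != 0].
Proof.
move=> vU; pose w := v - projv U v.
have [i wi] : exists i, coord (vbasis {:V}) i w != 0.
  apply/existsP; apply: contraR vU; rewrite negb_exists => /forallP w0.
  have : w = 0.
    rewrite (coord_vbasis (memvf w)) big1 // => i _.
    by have /negPn/eqP -> := w0 i; rewrite scale0r.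
  by move/eqP; rewrite subr_eq0 => /eqP ->; exact: memv_proj.
exists (fun u => coord (vbasis {:V}) i (u - projv U u)); split => //.
- by move=> c u u'; rewrite linearP opprD addrACA -scalerBr linearP.
- by move=> u uU; rewrite projv_id // subrr linear0.
Qed.

(** The double annihilator of a subspace of a finite-dimensional space is the subspace itself. This
    turns the vanishing pairings of the remainder in the descent hypothesis into membership in the
    hit elements of B(4). *)
Lemma hit_deg_of_KSigma d (b : P4) : b \in graded B4 d ->
  (forall Theta, KSigma d Theta -> Theta b = 0) -> hit_deg B4 d b.
Proof.
move=> /gradedB4[_ bh] Hb.
have [|c u v|U HU] := @submodule_vspace _ (dhomog 4 'F_2 d)
  (fun v => hit_deg B4 d (mpoly_of_dhomog v)).
- exact: hit_deg0.
- exact: hit_deg_lin.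
have ind (p : P4) : p \is d.-homog -> mpoly_of_dhomog (indhomog d p) = p.
  by move=> ph; rewrite /indhomog /insubd insubT.
rewrite -(ind b bh); apply/HU/negPn/negP => /separating_functional[f [flin fU /eqP]].
(* [indhomog] returns a default value off degree [d]; only values on homogeneous polynomials matter
   for [KSigma]. *)
apply; apply: (Hb (fun p => f (indhomog d p))); split=> [c p q|p Hp].
  move=> /gradedB4[_ ph] /gradedB4[_ qh]; rewrite -flin; congr f.
  by apply: val_inj; rewrite /= !ind // rpredD // rpredZ.
by apply: fU; apply/HU; rewrite ind //; exact: hit_deg_homog Hp.
Qed.

(** * Assembling the cases *)

Lemma orbit_sum_hit d F :
  ((mu d <= 4)%N -> relative_descent_hypothesis d) ->
  mdeg F = d -> hit_deg P4full d 'X_[F] -> hit_deg B4 d (orbit_sum F).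
Proof.
move=> descent; move: F.
apply: (@block_induction d (fun G F => measure_lt (measure_of G) (measure_of F))).
- by move=> F; exact: measure_lt_irr.
- by move=> G F H; exact: measure_lt_trans.
move=> F Fd IH FH; have [mud|mud] := leqP (mu d) 4; last exact: orbit_sum_hit_mu_gt4.
case: (classic (exists2 w, is_omega_min d w & lex_lt (omega F) w)) => [[w wmin Fw]|N].
  exact: orbit_sum_hit_omega_lt wmin Fd Fw.
case: (altP (stabilizer F =P [set 1%g])) => [stabF|stabF].
  exact: orbit_sum_hit_free.
have [|h [p [r [[hH [l [c [lP ->]]] [rB _]] [-> _ rK]]]]] :=
  descent mud F Fd FH _ stabF.
  by move=> w wmin Fw; apply: N; exists w.
apply: hit_degD; last by apply: hit_deg_of_KSigma => // Theta; exact: rK.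
apply: hit_degD => //; apply: hit_deg_sum => G.
(* Every monomial of the descent term lies in the list [l], so it is hit in P(4) with smaller
   measure and the induction hypothesis applies. *)
move=> /msupp_sum_le/flattenP[ms /mapP[G']]; rewrite filter_predT => /lP[G'd lt_G' G'H] ->.
move=> /msuppZ_le /mem_msuppXP <-; apply: hit_degZ; exact: IH.
Qed.

Theorem theorem1p2
  (descent : forall d : nat, (mu d <= 4)%N -> relative_descent_hypothesis d)
  (a : 'X_{1..4}) :
  hit P4full 'X_[a]%R -> hit B4 (orbit_sum a).
Proof.
move=> [n [h Hh Ea]]; set d := mdeg a.
have aH : hit_deg P4full d 'X_[a].
  (* Taking degree-d components isolates the single summand [h d]. *)
  have Ed : 'X_[a] = \sum_(e < n) pihomog mdeg d (h e).
    rewrite -(raddf_sum (pihomog mdeg d)) -Ea /= pihomogX /= eqxx; reflexivity.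
  have hE (e : 'I_n) : (e : nat) != d -> pihomog mdeg d (h e) = 0.
    by move=> ed; exact: pihomog_ne0 ed (hit_deg_homog (Hh e (ltn_ord e))).
  have [dn|nd] := ltnP d n.
    rewrite Ed (bigD1 (Ordinal dn)) //= big1 ?addr0.
      by rewrite (pihomog_dE (hit_deg_homog (Hh d dn))); exact: Hh.
    by move=> e ed; apply: hE; apply: contraNneq ed => E; apply/eqP/val_inj.
  (* If [d] is not among the summation degrees, every component vanishes, which is absurd for a
     monomial. *)
  have : 'X_[a] = 0 :> P4.
    by rewrite Ed big1 // => e _; apply: hE; rewrite ltn_eqF // (leq_trans _ nd).
  by move/(congr1 (mcoeff a))/eqP; rewrite mcoeffX eqxx mcoeff0 oner_eq0.
exists d.+1, (fun e => if e == d then orbit_sum a else 0).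
  move=> e _; case: eqP => [->|_]; last exact: hit_deg0.
  exact: orbit_sum_hit (descent d) _ aH.
rewrite big_ord_recr /= eqxx big1 ?add0r // => e _.
by rewrite ltn_eqF.
Qed.
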